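(* Let $\mathcal{H}$ be a finite nonempty family of tournaments. If $\mathcal{H}$ has the $(\mathcal{F},v,\eta)$-strong EH-property (for some $v,\eta,\mathcal{F}$), then $\mathcal{H}$ has the EH-property.
   Context: Tournaments are finite; a subtournament is an induced subtournament on a subset of vertices; a tournament is transitive if it has no directed cycle. For a tournament $T$, $tr(T)$ is the maximum size of a transitive subtournament of $T$. A set $V_1$ is complete to $V_2$ if every vertex of $V_1$ is adjacent to (has an edge to) every vertex of $V_2$. For disjoint nonempty $X,Y\subseteq V(T)$, $d(X,Y)=e_{X,Y}/(|X||Y|)$ where $e_{X,Y}$ is the number of edges $(x,y)$ with $x\in X,y\in Y$. For a $\{0,1\}$-vector $v$ of length $m$, let $\zeta^v(i)=|\{j\le i: v(j)=1\}|$. Let $\eta$ be a vector of positive integers of length $\zeta^v(m)$ and $k=|\{j:v(j)=0\}|+\sum_i \eta(i)$. For a tournament $T$, $c>0$, $0\le\lambda<1$, a $(v,\eta,c,\lambda)$-m-sequence in $T$ is a sequence $\chi=(S_1,\dots,S_m)$ of pairwise disjoint subsets of $V(T)$ such that: if $v(i)=1$ then $S_i$ induces a transitive subtournament and is partitioned into $\eta(\zeta^v(i))$ sets $S_{i,1},\dots,S_{i,\eta(\zeta^v(i))}$ with $S_{i,a}$ complete to $S_{i,b}$ for $a<b$ and $|S_{i,a}|\ge c\,tr(T)$ for all $a$; if $v(i)=0$ then $|S_i|\ge c|T|$; and $d(S_i,S_j)\ge 1-\lambda$ for all $i<j$. Its long representation $l(\chi)=(T_1,\dots,T_k)$ is obtained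 from $\chi$ by replacing each $S_i$ with $v(i)=1$ by $S_{i,1},\dots,S_{i,\eta(\zeta^v(i))}$ in this order; $V(\chi)=\bigcup S_i$. A $c'$-strong pair in $\chi$ is a pair $(A,B)$ of disjoint subsets of $V(\chi)$ with $|A|\ge c'|T|$, such that either $|B|\ge c'|T|$ or ($B$ induces a transitive subtournament and $|B|\ge c'\,tr(T)$), and such that $d(A,B)=1$ or $d(B,A)=1$. Let $\mathcal{H}=\{H_1,\dots,H_t\}$ be a finite family of tournaments with $V(H_i)=\{h^i_1,\dots,h^i_{|H_i|}\}$, and $\mathcal{F}=\{f_1,\dots,f_t\}$ with $f_i:V(H_i)\to\{1,\dots,k\}$ injective. $\mathcal{H}$ has the $(\mathcal{F},v,\eta)$-strong EH-property if for every $c_1>0$ there exist $\lambda_0>0$ and $c_2>0$ such that for every tournament $T$, every $0\le\lambda\le\lambda_0$ and every $(v,\eta,c_1,\lambda)$-m-sequence $\chi$ in $T$ with $l(\chi)=(T_1,\dots,T_k)$, either (i) there exist $i$ and vertices $x_1,\dots,x_{|H_i|}$ with $x_j\in T_{f_i(h^i_j)}$ such that $x_j\mapsto h^i_j$ is an isomorphism from the subtournament induced on $\{x_1,\dots,x_{|H_i|}\}$ onto $H_i$, or (ii) $\chi$ contains a $c_2$-strong pair. A finite family $\mathcal{H}$ has the EH-property if there is $\epsilon>0$ such that every tournament $T$ containing no member of $\mathcal{H}$ as a subtournament contains a transitive subtournament on at least $|T|^{\epsilon}$ vertices. *)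

(* Defs.v *)
From HB Require Import structures.
From mathcomp Require Import all_boot all_order all_algebra.
From mathcomp Require Import boolp reals exp.

Set Implicit Arguments.
Unset Strict Implicit.
Unset Printing Implicit Defensive.

Import Order.TTheory GRing.Theory Num.Theory.
Local Open Scope ring_scope.

(* As usual, a tournament has at least one vertex. *)
Record tournament : Type := Tournament {
  vertex :> finType;
  edge : rel vertex;
  edge_irr : irreflexive edge;
  edge_xor : forall x y : vertex, x != y -> edge x y (+) edge y x;
  vertex_gt0 : (0 < #|vertex|)%N }.

Definition embedding (H T : tournament) (x : H -> T) : Prop :=
  injective x /\ forall h h' : H, edge (x h) (x h') = edge h h'.

Definition contains_copy (T H : tournament) : Prop :=
  exists x : H -> T, embedding x.

Section InTournament.
Variable T : tournament.
Implicit Types X Y : {set T}.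

(* The subtournament induced on X has no directed cycle. *)
Definition transitive_on X : Prop :=
  forall p : seq T, {subset p <= X} -> ucycle (@edge T) p -> p = [::].

Definition tr : nat := \max_(X : {set T} | `[< transitive_on X >]) #|X|.

Definition complete_to X Y : Prop :=
  forall x y : T, x \in X -> y \in Y -> edge x y.

Definition edges_between X Y : nat :=
  #|[set p : T * T | [&& p.1 \in X, p.2 \in Y & edge p.1 p.2]]|.

(* Only meaningful for nonempty X and Y; it is 0 when X or Y is empty. *)
Definition density (R : realType) X Y : R :=
  (edges_between X Y)%:R / (#|X| * #|Y|)%:R.

End InTournament.

(* Positions are numbered from 0: the position i : 'I_m stands for i + 1, so
   that zeta v i is the number of ones among the first i + 1 entries of v. *)
Definition zeta (m : nat) (v : m.-tuple bool) (i : 'I_m) : nat :=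
  #|[set j : 'I_m | (j <= i)%N && tnth v j]|.

(* The entry of eta of (1-based) index zeta v i; used only when v(i) = 1. *)
Definition eta_at (m : nat) (v : m.-tuple bool)
    (eta : (count id v).-tuple nat) (i : 'I_m) : nat :=
  nth 0%N eta (zeta v i).-1.

Definition long_length (m : nat) (v : m.-tuple bool)
    (eta : (count id v).-tuple nat) : nat :=
  (count negb v + sumn eta)%N.

(* The sets S_1, ..., S_m, together with, for v(i) = 1, the chosen ordered
   partition S_{i,1}, S_{i,2}, ... of S_i; ms_part chi i is ignored when
   v(i) = 0. *)
Record mseq_data (m : nat) (T : tournament) : Type := MSeqData {
  ms_set : 'I_m -> {set T};
  ms_part : 'I_m -> seq {set T} }.

Definition ordered_partition (T : tournament) (S : {set T})
    (P : seq {set T}) : Prop :=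
  [/\ S = \bigcup_(X <- P) X,
      forall a b : nat, (a < b < size P)%N ->
        [disjoint nth set0 P a & nth set0 P b] &
      forall a b : nat, (a < b < size P)%N ->
        complete_to (nth set0 P a) (nth set0 P b)].

Definition is_mseq (R : realType) (m : nat) (v : m.-tuple bool)
    (eta : (count id v).-tuple nat) (c lambda : R) (T : tournament)
    (chi : mseq_data m T) : Prop :=
  [/\ 0 < c /\ 0 <= lambda < 1,
      forall i j : 'I_m, i != j -> [disjoint ms_set chi i & ms_set chi j],
      forall i : 'I_m, tnth v i = true ->
        [/\ transitive_on (ms_set chi i),
            size (ms_part chi i) = eta_at eta i,
            ordered_partition (ms_set chi i) (ms_part chi i) &
            forall X, X \in ms_part chi i -> c * (tr T)%:R <= #|X|%:R],
      forall i : 'I_m, tnth v i = false ->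
        c * #|T|%:R <= #|ms_set chi i|%:R &
      forall i j : 'I_m, (i < j)%N ->
        1 - lambda <= density R (ms_set chi i) (ms_set chi j)].

(* For an m-sequence this list has length long_length eta. *)
Definition long_rep (m : nat) (v : m.-tuple bool) (T : tournament)
    (chi : mseq_data m T) : seq {set T} :=
  flatten [seq if tnth v i then ms_part chi i else [:: ms_set chi i]
          | i <- enum 'I_m].

Definition ms_support (m : nat) (T : tournament) (chi : mseq_data m T)
    : {set T} :=
  \bigcup_(i < m) ms_set chi i.

Definition strong_pair (R : realType) (m : nat) (T : tournament)
    (chi : mseq_data m T) (c : R) (A B : {set T}) : Prop :=
  [/\ A \subset ms_support chi /\ B \subset ms_support chi,
      [disjoint A & B],
      c * #|T|%:R <= #|A|%:R,
      c * #|T|%:R <= #|B|%:R \/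
        (transitive_on B /\ c * (tr T)%:R <= #|B|%:R) &
      density R A B = 1 \/ density R B A = 1].

Definition strong_EH_property (R : realType) (t : nat)
    (H : 'I_t -> tournament) (m : nat) (v : m.-tuple bool)
    (eta : (count id v).-tuple nat)
    (F : forall i : 'I_t, H i -> 'I_(long_length eta)) : Prop :=
  forall c1 : R, 0 < c1 ->
  exists lambda0 c2 : R,
    [/\ 0 < lambda0, 0 < c2 &
    forall (T : tournament) (lambda : R) (chi : mseq_data m T),
      0 <= lambda <= lambda0 ->
      is_mseq eta c1 lambda chi ->
      (exists (i : 'I_t) (x : H i -> T),
         (forall h : H i, x h \in nth set0 (long_rep v chi) (F i h)) /\
         embedding x) \/
      (exists A B : {set T}, strong_pair chi c2 A B)].

Definition EH_property (R : realType) (t : nat) (H : 'I_t -> tournament)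
    : Prop :=
  exists2 eps : R, 0 < eps &
    forall T : tournament,
      (forall i : 'I_t, ~ contains_copy T (H i)) ->
      exists X : {set T},
        transitive_on X /\ (#|T|%:R : R) `^ eps <= #|X|%:R.

(* Main.v *)
(** The classical Erdős–Hajnal embedding shows that in a large H-free
    tournament T one finds, for any prescribed function l, a scale n bounded
    independently of T and sets S_1, ..., S_m of size at least |T|/n whose
    pairwise densities are at least 1 - 1/l(n).  Since n precedes l(n), the
    quantifiers of the strong EH-property (c_1 first, then lambda_0) are met.
    For small eps, in a minimal counterexample T to the EH-property with
    exponent eps, every set of linear size contains a transitive subset of size
    close to tr(T), which turns the S_i into an m-sequence.  The strong pair
    (A, B) it must contain is impossible: gluing a transitive subset of A to one
    of B would exceed tr(T). *)
Require Import Defs.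
From mathcomp Require Import all_boot all_order all_algebra.
From mathcomp Require Import boolp reals exp.
From mathcomp Require Import zify lra.

Set Implicit Arguments.
Unset Strict Implicit.
Unset Printing Implicit Defensive.

Import Order.TTheory GRing.Theory Num.Theory.

(** * Transitive sets as chains *)

Section Chains.
Variable T : tournament.
Implicit Types (s : seq T) (X Y : {set T}).

Lemma edgeC (x y : T) : x != y -> edge y x = ~~ edge x y.
Proof. by move=> /edge_xor; case: edge; case: edge. Qed.

Lemma edge_asym (x y : T) : edge x y -> edge y x = false.
Proof.
case: (eqVneq x y) => [->|/edgeC -> ->//]; by rewrite edge_irr.
Qed.

Lemma chain_uniq s : pairwise (@edge T) s -> uniq s.
Proof. exact/pairwise_uniq/edge_irr. Qed.

(** Along an edge between members of [s] the position in [s] strictly increases, so no directed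
    cycle can close up. *)
Lemma chain_transitive s :
  pairwise (@edge T) s -> transitive_on [set x in s].
Proof.
move=> s_chain p ps /andP[p_cyc _].
pose r x y := (index x s < index y s)%N.
have r_trans : transitive r by move=> y x z; apply: ltn_trans.
have edge_r : {in s &, forall x y, edge x y -> r x y}.
  move=> x y xs ys exy; rewrite /r ltnNge leq_eqVlt negb_or.
  have nxy : y != x by apply: contraTneq exy => ->; rewrite edge_irr.
  apply/andP; split.
    by apply: contraNneq nxy => /(index_inj y ys xs)->.
  apply/negP => lt_yx; have := edge_asym exy.
  have /(pairwiseP x)/(_ (index y s) (index x s)) := s_chain.
  by rewrite !inE !index_mem !nth_index // => ->.
have ps' : {subset p <= s} by move=> x /ps; rewrite inE.
case: p p_cyc ps ps' => [//|x p] p_cyc _ ps'.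
have : cycle r (x :: p).
  apply: (sub_in_cycle edge_r) p_cyc; exact/allP.
rewrite /= => /(order_path_min r_trans).
by rewrite all_rcons /r ltnn.
Qed.

(** Without directed triangles the reflexive closure of [edge] is a total order on [X]; sorting by
    it gives the chain. *)
Lemma transitive_chain X : transitive_on X ->
  exists2 s, pairwise (@edge T) s & X = [set x in s].
Proof.
move=> X_tr; pose r (x y : T) := (x == y) || edge x y.
have r_total : total r.
  move=> x y; rewrite /r [y == x]eq_sym.
  by case: (eqVneq x y) => //= /edgeC ->; apply: orbN.
have r_trans : {in X & &, transitive r}.
  move=> y x z yX xX zX; rewrite /r.
  case: (eqVneq x y) => [->//|nxy /=] exy.
  case: (eqVneq y z) => [<-|nyz /=]; first by rewrite exy orbT.
  move=> eyz; case: (eqVneq x z) => [//|nxz] /=.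
  apply: contraPT (X_tr [:: x; y; z]) => nexz all_cyc.
  have ezx : edge z x by rewrite (edgeC nxz).
  suff: [:: x; y; z] = [::] by [].
  apply: all_cyc; first by move=> u; rewrite !inE => /or3P[] /eqP ->.
  by rewrite /ucycle /= exy eyz ezx !inE negb_or nxy nxz nyz.
exists (sort r (enum X)); last by apply/setP => x; rewrite inE mem_sort mem_enum.
have all_X : all (mem X) (sort r (enum X)).
  by apply/allP => x; rewrite mem_sort mem_enum.
have : pairwise r (sort r (enum X)).
  rewrite -(sorted_pairwise_in r_trans) //; exact: sort_sorted.
have : uniq (sort r (enum X)) by rewrite sort_uniq enum_uniq.
rewrite uniq_pairwise => u p.
have := pairwise_relI (fun x y => x != y) r (sort r (enum X)).
rewrite u p /= => /idP; apply: sub_pairwise => x y /=.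
by rewrite /r; case: eqP.
Qed.

Lemma tr_ge_chain s : pairwise (@edge T) s -> (size s <= tr T)%N.
Proof.
move=> s_chain; rewrite -(card_uniqP (chain_uniq s_chain)) -cardsE.
by apply: leq_bigmax_cond; apply/asboolP/chain_transitive.
Qed.

Lemma tr_chain : exists2 s, pairwise (@edge T) s & size s = tr T.
Proof.
pose A := [pred X : {set T} | `[< transitive_on X >]].
have A_gt0 : (0 < #|A|)%N.
  apply/card_gt0P; exists set0; apply/asboolP => -[|x p] // ps.
  by have := ps x (mem_head _ _); rewrite inE.
have [X /asboolP X_tr trE] := eq_bigmax_cond (fun X : {set T} => #|X|) A_gt0.
have [s s_chain XE] := transitive_chain X_tr.
exists s => //; rewrite [tr T]trE XE cardsE.
by apply/esym/card_uniqP/chain_uniq.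
Qed.

(** Any vertex extends a chain taken in the larger of its out- and in-neighbourhoods, at the cost of
    halving the set. *)
Lemma chain_log k X : (2 ^ k <= #|X|)%N ->
  exists2 s, pairwise (@edge T) s & {subset s <= X} /\ size s = k.+1.
Proof.
elim: k X => [|k IHk] X.
  by case/card_gt0P => x xX; exists [:: x] => //; split=> // y /[!inE] /eqP ->.
rewrite expnS => cX.
have [x xX] : exists x, x \in X by apply/card_gt0P; lia.
pose O := [set y in X | edge x y]; pose I := [set y in X | edge y x].
have cXE : #|X| = (#|O| + #|I|).+1.
  rewrite (cardsD1 x) xX add1n; congr _.+1.
  have -> : X :\ x = O :|: I.
    apply/setP => y; rewrite !inE; case: (y \in X); rewrite ?andbF //= andbT.
    case: (eqVneq y x) => [->|/edgeC ->]; first by rewrite edge_irr.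
    by case: edge.
  rewrite cardsU; suff -> : O :&: I = set0 by rewrite cards0 subn0.
  apply/setP => y; rewrite !inE; apply/negbTE/negP => /andP[/andP[_ exy]].
  by rewrite (edge_asym exy) andbF.
have [leO|leI] : (2 ^ k <= #|O|)%N \/ (2 ^ k <= #|I|)%N by lia.
  have [s s_chain [sO <-]] := IHk _ leO; exists (x :: s) => //=.
    by rewrite s_chain andbT; apply/allP => y /sO; rewrite inE => /andP[].
  by split=> // y; rewrite inE => /predU1P[-> //|/sO]; rewrite inE => /andP[].
have [s s_chain [sI <-]] := IHk _ leI; exists (rcons s x).
  rewrite pairwise_rcons s_chain andbT.
  by apply/allP => y /sI; rewrite inE => /andP[].
split; last by rewrite size_rcons.
by move=> y; rewrite mem_rcons inE => /predU1P[-> //|/sI]; rewrite inE => /andP[].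
Qed.

(** Blocks of [q] consecutive vertices are cut off the front; the last part absorbs the
    remainder. *)
Lemma chain_cut s k q : pairwise (@edge T) s -> (k.+1 * q <= size s)%N ->
  exists P : seq {set T}, [/\ size P = k.+1, ordered_partition [set x in s] P &
    forall X, X \in P -> (q <= #|X|)%N].
Proof.
elim: k s => [|k IHk] s s_chain les.
  exists [:: [set x in s]]; split=> //.
    split; first by rewrite big_seq1.
    - by move=> a b; rewrite /=; case: b => [|b]; rewrite ?andbF.
    - by move=> a b; rewrite /=; case: b => [|b]; rewrite ?andbF.
  move=> X; rewrite inE => /eqP ->.
  by rewrite cardsE (card_uniqP (chain_uniq s_chain)); lia.
move: (s_chain); rewrite -{1}(cat_take_drop q s) pairwise_cat.
move=> /and3P[/allrelP cross t_chain d_chain].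
have [|P [szP [PU Pdis Pcomp] Pq]] := IHk _ d_chain.
  by rewrite size_drop; lia.
have s_uniq := chain_uniq s_chain.
have nthP a : nth set0 P a \subset [set x in drop q s].
  case: (ltnP a (size P)) => aP; last by rewrite nth_default ?sub0set.
  by rewrite PU (big_rem _ (mem_nth set0 aP)) subsetUl.
exists ([set x in take q s] :: P); split; first by rewrite /= szP.
  split.
  - rewrite big_cons -PU; apply/setP => x.
    by rewrite !inE -mem_cat cat_take_drop.
  - move=> [|a] [|b] //=; last exact: Pdis.
    move=> _; rewrite -setI_eq0; apply/eqP/setP => x.
    rewrite !inE; apply/negbTE/negP => /andP[xt xP].
    have := subsetP (nthP b) _ xP; rewrite inE => xd.
    move: s_uniq; rewrite -(cat_take_drop q s) cat_uniq => /and3P[_ /hasPn h _].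
    by have := h _ xd; rewrite xt.
  - move=> [|a] [|b] //=; last exact: Pcomp.
    move=> _ x y; rewrite inE => xt yP; apply: cross => //.
    by have := subsetP (nthP b) _ yP; rewrite inE.
move=> X; rewrite inE => /predU1P[->|/Pq//].
rewrite cardsE (card_uniqP (take_uniq _ s_uniq)) size_take.
by case: ltnP => //; move: les; rewrite mulSn; lia.
Qed.

End Chains.

(** * Sparse families *)

Section Weights.
Variable V : finType.
Implicit Types (r : rel V) (A B : {set V}).

Definition weight r A B : nat := \sum_(x in A) \sum_(y in B) r x y.

Lemma weightC r A B : weight r A B = weight (fun x y => r y x) B A.
Proof. exact: exchange_big. Qed.

Lemma weight_sub r A B A' B' : A' \subset A -> B' \subset B ->
  weight r A' B' <= weight r A B.
Proof.
move=> sA sB; apply: (leq_trans (n := \sum_(x in A') \sum_(y in B) r x y)).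
  apply: leq_sum => x _; rewrite [leqRHS](big_setID B') /=.
  by rewrite (setIidPr sB) leq_addr.
by rewrite /weight [leqRHS](big_setID A') /= (setIidPr sA) leq_addr.
Qed.

Lemma eq_weight r r' A B : {in A & B, r =2 r'} -> weight r A B = weight r' A B.
Proof.
move=> rr'; apply: eq_bigr => x xA; apply: eq_bigr => y yB.
by rewrite rr'.
Qed.

Lemma weight_total A B : weight (fun _ _ => true) A B = #|A| * #|B|.
Proof.
rewrite /weight (eq_bigr (fun=> #|B|)) => [|x _]; first by rewrite sum_nat_const.
by rewrite sum1_card.
Qed.

Lemma weightD r A B :
  weight r A B + weight (fun x y => ~~ r x y) A B = #|A| * #|B|.
Proof.
rewrite -weight_total /weight -big_split /=; apply: eq_bigr => x _.
by rewrite -big_split /=; apply: eq_bigr => y _; case: r.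
Qed.

Definition degree r B x : nat := \sum_(y in B) r x y.

Lemma degreeE r B x : degree r B x = #|[set y in B | r x y]|.
Proof.
rewrite /degree -sum1_card [RHS](eq_bigl _ _ (in_set _)) big_mkcondr /=.
by apply: eq_bigr => y _; case: r.
Qed.

Lemma weight_light r L A B :
  (forall x, x \in A -> L * degree r B x <= #|B|) ->
  L * weight r A B <= #|A| * #|B|.
Proof. by move=> le; rewrite big_distrr -sum_nat_const; apply: leq_sum. Qed.

(** A Markov bound: small total weight leaves few vertices of large degree. *)
Lemma weight_heavy r L A B :
  #|[set x in A | #|B| < L * degree r B x]| * #|B| <= L * weight r A B.
Proof.
rewrite -sum_nat_const /weight big_distrr /= [leqRHS](big_setID
  [set x in A | #|B| < L * degree r B x]) /=.
apply: leq_trans (leq_addr _ _); rewrite (setIidPr _).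
  by apply: leq_sum => x; rewrite inE => /andP[_ /ltnW].
by apply/subsetP => x; rewrite inE => /andP[].
Qed.

End Weights.

Lemma leq_card_bigcup (I : finType) (V : finType) (P : pred I)
    (B : I -> {set V}) : #|\bigcup_(i | P i) B i| <= \sum_(i | P i) #|B i|.
Proof.
elim/big_rec2: _ => [|i n A _ le]; first by rewrite cards0.
by rewrite cardsU; lia.
Qed.

(* Replacing the sets one at a time costs a factor [2 * #|I|] of sparsity at
   each step: at least half of the vertices of the current set have small
   degree to every other set. *)
Lemma clean_family (I V : finType) (R : I -> I -> rel V) (Q : I -> {set V} -> Prop)
    (S : I -> {set V}) (l : nat) :
    (forall i j x y, R i j x y = R j i y x) ->
    (forall i, 0 < #|S i|) ->
    (forall i (Y : {set V}), Y \subset S i -> #|S i| <= 2 * #|Y| ->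
       exists Z : {set V}, [/\ Z \subset Y, 0 < #|Z| & Q i Z]) ->
    (forall i j, i != j ->
       (2 * #|I|) ^ #|I| * l * weight (R i j) (S i) (S j) <= #|S i| * #|S j|) ->
  exists Z : I -> {set V}, [/\ forall i, Z i \subset S i, forall i, Q i (Z i) &
    forall i j, i != j ->
      l * weight (R i j) (Z i) (Z j) <= #|Z i| * #|Z j|].
Proof.
move=> RC S_gt0 SQ Ssp.
(* An intermediate stage of the replacement: the indices already treated satisfy [Q], the others
   still carry [S i], and each replacement has spent one factor [2 * #|I|]. *)
suff [Z [ZS _ ZQ Zsp]] : exists Z : I -> {set V}, [/\ forall i, Z i \subset S i,
    forall i, 0 < #|Z i|,
    forall i, if i \in enum I then Q i (Z i) else Z i = S i &
    forall i j, i != j ->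
      (2 * #|I|) ^ (#|I| - size (enum I)) * l * weight (R i j) (Z i) (Z j)
        <= #|Z i| * #|Z j|].
  exists Z; split=> // [i|i j ij]; first by have := ZQ i; rewrite mem_enum.
  by have := Zsp i j ij; rewrite -cardE subnn mul1n.
have : size (enum I) <= #|I| by rewrite cardE.
elim: (enum I) (enum_uniq I) => [_ _|k s IHs /= /andP[ks s_uniq] le_s].
  by exists S; split=> // i j ij; rewrite subn0; apply: Ssp.
have [Z [ZS Z0 ZQ Zsp]] := IHs s_uniq (ltnW le_s).
set L := (2 * #|I|) ^ (#|I| - (size s).+1) * l.
have Zsp' i j : i != j ->
    2 * #|I| * L * weight (R i j) (Z i) (Z j) <= #|Z i| * #|Z j|.
  move=> ij; apply: leq_trans (Zsp i j ij).
  by rewrite /L mulnA -expnS -subSn.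
(* By the Markov bound each [bad j] fills at most [1 / (2 * #|I|)] of [Z k], so together they fill
   at most half. *)
pose bad j := [set x in Z k | #|Z j| < L * degree (R k j) (Z j) x].
pose Y := Z k :\: \bigcup_(j | j != k) bad j.
have bad_le j : j != k -> 2 * #|I| * #|bad j| <= #|Z k|.
  move=> jk; rewrite -(leq_pmul2r (Z0 j)) -mulnA.
  apply: leq_trans (Zsp' k j _); last by rewrite eq_sym.
  by rewrite -[leqRHS]mulnA leq_mul2l weight_heavy orbT.
have I_gt0 : 0 < #|I| by apply/card_gt0P; exists k.
have bigbad_le : 2 * #|\bigcup_(j | j != k) bad j| <= #|Z k|.
  rewrite -(leq_pmul2l I_gt0).
  apply: (@leq_trans (\sum_(j | j != k) #|Z k|)).
    rewrite mulnCA mulnA.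
    apply: leq_trans (leq_mul (leqnn _) (leq_card_bigcup _ _)) _.
    by rewrite big_distrr /=; apply: leq_sum => j /bad_le.
  by rewrite sum_nat_const leq_mul2r max_card orbT.
have Y_half : #|Z k| <= 2 * #|Y|.
  have : #|\bigcup_(j | j != k) bad j :&: Z k| <= #|\bigcup_(j | j != k) bad j|.
    by apply/subset_leq_card/subsetIl.
  rewrite setIC => le_I; have := cardsID (\bigcup_(j | j != k) bad j) (Z k).
  rewrite -/Y; lia.
have ZkE : Z k = S k by have := ZQ k; rewrite (negbTE ks).
have YZ : Y \subset Z k by apply: subsetDl.
have [W [WY W0 WQ]] := SQ k Y (subset_trans YZ (ZS k)) ltac:(by rewrite -ZkE).
(* Small degrees are inherited by every subset of [Y], which is why [Q] may select a very small
   set. *)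
have WZ j : j != k -> L * weight (R k j) W (Z j) <= #|W| * #|Z j|.
  move=> jk; apply: weight_light => x /(subsetP WY); rewrite inE.
  case/andP=> /bigcupP xbad xZ; rewrite leqNgt; apply/negP => x_bad.
  by apply: xbad; exists j => //; rewrite inE xZ.
exists (fun i => if i == k then W else Z i); split=> [i|i|i|i j ij].
- by case: eqP => // ->; apply: subset_trans WY (subset_trans YZ (ZS k)).
- by case: eqP.
- by rewrite inE; case: eqP => [->//|_]; apply: ZQ.
- rewrite -/L; case: eqP => [ik|_].
    by rewrite -ik eq_sym (negbTE ij) ik; apply: WZ; rewrite -ik eq_sym.
  case: eqP => [jk|_]; last first.
    apply: leq_trans (Zsp' i j ij); rewrite -mulnA leq_pmull //; lia.
  rewrite weightC [leqRHS]mulnC jk.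
  rewrite (_ : weight _ _ _ = weight (R k i) W (Z i)).
    by apply: WZ; rewrite -jk.
  by apply: eq_weight => x y _ _; rewrite RC.
Qed.

(** * Dense sequences *)

Lemma edge_eqC (T U : tournament) (x y : T) (u v : U) : x != y -> u != v ->
  edge x y = edge u v -> edge y x = edge v u.
Proof. by move=> /edgeC -> /edgeC -> ->. Qed.

Definition free_on (T H : tournament) (X : {set T}) : Prop :=
  ~ exists2 x : H -> T, embedding x & forall h, x h \in X.

(** The edges from [B] back to [A] make up at most the fraction [1 / l] of all pairs. *)
Definition dominates (T : tournament) (l : nat) (A B : {set T}) : bool :=
  [disjoint A & B] && (l * weight (@edge T) B A <= #|A| * #|B|).

(** Shrinking [B] by a factor of at most [n] multiplies the proportion of backward edges by at most
    [n]. *)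
Lemma dominates_sub (T : tournament) l l' n (A B B' : {set T}) :
  0 < n -> B' \subset B -> #|B| <= n * #|B'| -> l' * n <= l ->
  dominates l A B -> dominates l' A B'.
Proof.
move=> n_gt0 sB leB le_l /andP[dAB wAB]; apply/andP; split.
  exact: disjointWr sB dAB.
rewrite -(leq_pmul2l n_gt0); apply: (@leq_trans (l * weight (@edge T) B A)).
  by rewrite mulnA [n * l']mulnC leq_mul // weight_sub.
apply: leq_trans wAB _; by rewrite mulnCA leq_mul.
Qed.

(* The Erdős–Hajnal embedding: the vertices of H are placed one by one, and a
   failure to place one exhibits a dense pair among the candidate sets. *)
Lemma embed_or_dominate (H : tournament) (l : nat -> nat) (s n : nat) :
  exists N, forall (T : tournament) (X : {set T}) (M : nat)
      (Z : H -> {set T}) (r : seq H),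
    size r = s -> uniq r -> 0 < M ->
    (forall v, v \in r -> Z v \subset X /\ M <= n * #|Z v|) ->
    {in r &, forall v w, v != w -> [disjoint Z v & Z w]} ->
    (exists2 x : H -> T, {in r, forall v, x v \in Z v} &
       {in r &, forall v w, v != w -> edge (x v) (x w) = edge v w}) \/
    (exists n' (A B : {set T}), [/\ n' <= N, A \subset X /\ B \subset X,
       M <= n' * #|A|, M <= n' * #|B| & dominates (l n') A B]).
Proof.
elim: s n => [|s IHs] n.
  exists 0 => T X M Z [|//] _ _ _ _ _; left.
  have /card_gt0P[x0 _] := vertex_gt0 T.
  by exists (fun=> x0).
(* A failure yields a subset of [Z v] of size at least [#|Z v| / s.+1]. This fixes its scale [n1],
   and thereby the density to test. *)
set n1 := n * s.+1; set L := l n1.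
have [N HN] := IHs (n * L).
exists (maxn n1 N) => T X M Z [//|v r] /= [sr] /andP[vr r_uniq] M_gt0 ZX Zdis.
have [ZvX leZv] := ZX v (mem_head _ _).
have ZX' w : w \in r -> Z w \subset X /\ M <= n * #|Z w|.
  by move=> wr; apply: ZX; rewrite inE wr orbT.
have Zdis' w : w \in r -> [disjoint Z v & Z w].
  move=> wr; apply: Zdis; rewrite ?mem_head // ?inE ?wr ?orbT //.
  by apply: contraNneq vr => ->.
(* Placing [v] at a vertex of [bad w] would leave less than the fraction [1 / L] of [Z w] for
   [w]. *)
pose ok w (x y : T) := edge x y == edge v w.
pose bad w := [set x in Z v | L * degree (ok w) (Z w) x < #|Z w|].
have [/hasP[w wr big_bad]|/hasPn small_bad] :=
    boolP (has (fun w => #|Z v| <= s.+1 * #|bad w|) r).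
  right; have [ZwX leZw] := ZX' w wr.
  have badZ : bad w \subset Z v by apply/subsetP => x; rewrite inE => /andP[].
  have badX := subset_trans badZ ZvX.
  have leM : M <= n1 * #|bad w|.
    by apply: leq_trans leZv _; rewrite -mulnA leq_mul2l big_bad orbT.
  have leM' : M <= n1 * #|Z w|.
    by apply: leq_trans leZw _; rewrite leq_mul // leq_pmulr.
  have dis : [disjoint bad w & Z w] := disjointWl badZ (Zdis' w wr).
  have light : L * weight (ok w) (bad w) (Z w) <= #|bad w| * #|Z w|.
    by apply: weight_light => x; rewrite inE => /andP[_ /ltnW].
  (* Most edges between [bad w] and [Z w] go against the pattern, so one set dominates the other, in
     the direction dictated by [edge v w]. *)
  have okE : weight (ok w) (bad w) (Z w) = if edge v w
      then weight (@edge T) (bad w) (Z w) else weight (@edge T) (Z w) (bad w).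
    case E: (edge v w); first by apply: eq_weight => x y _ _; rewrite /ok E eqb_id.
    rewrite [RHS]weightC; apply: eq_weight => x y xb yZ.
    rewrite /ok E eqbF_neg (@edgeC _ x y) //.
    by apply: contraTneq yZ => <-; rewrite (disjointFr dis xb).
  rewrite okE in light.
  case: (edge v w) light => light.
    exists n1, (Z w), (bad w); split; rewrite ?leq_maxl //.
    by rewrite /dominates disjoint_sym dis mulnC [#|_| * _]mulnC /= mulnC.
  exists n1, (bad w), (Z w); split; rewrite ?leq_maxl //.
  by rewrite /dominates dis.
(* The [s] bad sets each fill less than [#|Z v| / s.+1], so they do not exhaust [Z v]. *)
have [x xZ x_good] : exists2 x, x \in Z v & {in r, forall w, x \notin bad w}.
  have : 0 < #|Z v :\: \bigcup_(w in r) bad w|.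
    have := cardsID (\bigcup_(w in r) bad w) (Z v).
    have : #|Z v :&: \bigcup_(w in r) bad w| <= #|\bigcup_(w in r) bad w|.
      by apply/subset_leq_card/subsetIr.
    have : s.+1 * #|\bigcup_(w in r) bad w| <= s * #|Z v|.
      apply: leq_trans (leq_mul (leqnn _) (leq_card_bigcup _ _)) _.
      rewrite big_distrr /= -{2}sr -(card_uniqP r_uniq) -sum_nat_const.
      by apply: leq_sum => w /small_bad; rewrite -ltnNge => /ltnW.
    have : 0 < #|Z v| by case: (#|Z v|) leZv => //; lia.
    move: #|Z v| #|\bigcup_(w in r) bad w| => a b; nia.
  case/card_gt0P=> x; rewrite inE => /andP[x_good xZ]; exists x => // w wr.
  by apply: contraNN x_good => xb; apply/bigcupP; exists w.
pose Z' w := [set y in Z w | ok w x y].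
have Z'Z w : Z' w \subset Z w by apply/subsetP => y; rewrite inE => /andP[].
have Z'X w : w \in r -> Z' w \subset X /\ M <= n * L * #|Z' w|.
  move=> wr; have [ZwX leZw] := ZX' w wr.
  split; first exact: subset_trans (Z'Z w) ZwX.
  apply: leq_trans leZw _; rewrite -mulnA leq_mul2l; apply/orP; right.
  by have := x_good w wr; rewrite inE xZ /= -leqNgt degreeE.
have Z'dis : {in r &, forall u w, u != w -> [disjoint Z' u & Z' w]}.
  move=> u w ur wr uw; apply: disjointWl (Z'Z u) (disjointWr (Z'Z w) _).
  by apply: Zdis => //; rewrite inE ?ur ?wr orbT.
have [[y yZ yE]|[n' [A [B [le_n' AX lA lB dAB]]]]] :=
    HN T X M Z' r sr r_uniq M_gt0 Z'X Z'dis; last first.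
  right; exists n', A, B; split=> //.
  by apply: leq_trans le_n' (leq_maxr _ _).
left; have xy w : w \in r -> x != y w /\ edge x (y w) = edge v w.
  move=> wr; have := yZ w wr; rewrite inE => /andP[yZw /eqP ->]; split=> //.
  by apply: contraTneq yZw => <-; rewrite (disjointFr (Zdis' w wr) xZ).
exists (fun u => if u == v then x else y u) => [u|u w].
  rewrite inE; case: (eqVneq u v) => [->|_] //= ur.
  by apply: (subsetP (Z'Z u)); apply: yZ.
rewrite !inE; case: (eqVneq u v) => [->|uv] /=.
  by case: (eqVneq w v) => [->|_] //= _ wr _; case: (xy w wr).
case: (eqVneq w v) => [->|_] /= ur.
  by move=> _ _; have [nxy exy] := xy u ur; apply: edge_eqC exy; rewrite // eq_sym.
by move=> wr uw; apply: yE.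
Qed.

Lemma split_set (V : finType) (I : eqType) (X : {set V}) (q : nat) (r : seq I) :
  uniq r -> size r * q <= #|X| ->
  exists Z : I -> {set V}, (forall i, i \in r -> Z i \subset X /\ #|Z i| = q) /\
    {in r &, forall i j, i != j -> [disjoint Z i & Z j]}.
Proof.
elim: r X => [|k r IHr] X /=; first by exists (fun=> set0).
case/andP=> kr r_uniq; rewrite mulSn => leX.
have /set0Pn[W] : [set W in powerset X | #|W| == q] != set0.
  apply/set0Pn; exists [set x in take q (enum X)].
  rewrite !inE cardsE (card_uniqP (take_uniq _ (enum_uniq _))) size_take -cardE.
  apply/andP; split; last by case: ltnP => //; lia.
  by apply/subsetP => x; rewrite inE => /mem_take; rewrite mem_enum.
rewrite !inE => /andP[WX /eqP cW].
have [|Z [Z_sub Z_dis]] := IHr (X :\: W) r_uniq.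
  by rewrite cardsD (setIidPr WX) cW; lia.
have WZ i : i \in r -> [disjoint W & Z i].
  move=> /Z_sub[ZX _]; rewrite disjoint_sym; apply: disjointWl ZX _.
  by rewrite disjoints_subset subDset setUCr subsetT.
have neq_k i : i \in r -> (i == k) = false by apply: contraTF => /eqP ->.
exists (fun i => if i == k then W else Z i); split=> [i|i j]; rewrite !inE.
  case: eqP => [_|_ /= ir]; first by split.
  have [ZX cZ] := Z_sub i ir; split=> //; exact: subset_trans ZX (subsetDl _ _).
case: (eqVneq i k) => [->|_] /= ir.
  by case: (eqVneq j k) => [->|jk /= jr] //; rewrite WZ.
by case: (eqVneq j k) => [_|jk /= jr ij]; [rewrite disjoint_sym WZ | apply: Z_dis].
Qed.

(* The scale [n] is chosen after the density [l n], so the density may be as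
   close to 1 as wanted in terms of the size of the two sets. *)
Lemma dominating_pair (H : tournament) (l : nat -> nat) :
  exists N, forall (T : tournament) (X : {set T}), free_on H X -> N <= #|X| ->
  exists n (A B : {set T}), [/\ 0 < n <= N, A \subset X /\ B \subset X,
    #|X| <= n * #|A|, #|X| <= n * #|B| & dominates (l n) A B].
Proof.
set h := #|H|; have h_gt0 : 0 < h := vertex_gt0 H.
(* Splitting [X] into [h] equal parts loses at most a factor 2 to rounding once [h <= #|X|]. *)
have [N HN] := embed_or_dominate H l h (2 * h).
exists (maxn h N) => T X X_free; rewrite geq_max => /andP[le_h le_N].
have X_gt0 : 0 < #|X| by apply: leq_trans le_h.
have [|Z [Z_sub Z_dis]] := @split_set T H X (#|X| %/ h) (enum H) (enum_uniq H).
  by rewrite -cardE mulnC leq_divM.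
have [||[x xZ xE]|[n [A [B [le_n sAB lA lB dAB]]]]] :=
    HN T X #|X| Z (enum H) _ (enum_uniq H) X_gt0 _ Z_dis.
- by rewrite -cardE.
- move=> v /Z_sub[ZX ->]; split=> //.
  have := divn_eq #|X| h; have := ltn_pmod #|X| h_gt0.
  have : 0 < #|X| %/ h by rewrite divn_gt0.
  by move: (_ %/ _) (_ %% _) => a b; nia.
- case: X_free; exists x; last first.
    by move=> v; have vH := mem_enum H v; apply: (subsetP (Z_sub v _).1); rewrite ?vH ?xZ.
  have xE' v w : v != w -> edge (x v) (x w) = edge v w.
    by apply: xE; rewrite mem_enum.
  split; last by move=> v w; case: (eqVneq v w) => [->|/xE'//]; rewrite !edge_irr.
  move=> v w xvw; apply/eqP/negPn/negP => vw.
  have := edge_xor vw; rewrite -(xE' v w vw) -(xE' w v) 1?eq_sym //.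
  by rewrite xvw edge_irr.
exists n, A, B; split=> //; rewrite (leq_trans le_n (leq_maxr _ _)) andbT.
by case: n lA {le_n lB dAB} => //; lia.
Qed.

(** A dominating pair [(A, B)] provides the first set [A]; the rest is found inside [B], where a
    relative scale [n'] means the scale [n * n'] in [X]. *)
Lemma dominating_sequence (H : tournament) (k : nat) (l : nat -> nat) :
  exists N, forall (T : tournament) (X : {set T}), free_on H X -> N <= #|X| ->
  exists n (S : seq {set T}), [/\ 0 < n <= N, size S = k,
    forall A, A \in S -> A \subset X /\ #|X| <= n * #|A| &
    pairwise (dominates (l n)) S].
Proof.
elim: k l => [|k IHk] l.
  by exists 1 => T X _ _; exists 1, [::]; split.
have /choice[N2 HN2] := fun n => IHk (fun n' => l (n * n')).
(* [A] has to dominate subsets of [B] of any relative scale [n' <= N2 n], and the passage to them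
   costs a factor [n']; the first density anticipates all these cases. *)
pose l1 n := \max_(n' < (N2 n).+1) (l (n * n') * n').
have [N1 HN1] := dominating_pair H l1.
pose N := \max_(n < N1.+1) (n * N2 n).
exists (maxn N1 N) => T X X_free; rewrite geq_max => /andP[leN1 leN].
have [n [A [B [/andP[n_gt0 le_n] [AX BX] lA lB dAB]]]] := HN1 T X X_free leN1.
have le_nN : n * N2 n <= N.
  exact: (leq_bigmax (Ordinal (le_n : n < N1.+1))).
have B_free : free_on H B.
  by case=> x x_emb xB; apply: X_free; exists x => // h; apply: (subsetP BX).
have leB : N2 n <= #|B|.
  rewrite -(leq_pmul2l n_gt0).
  exact: leq_trans le_nN (leq_trans leN lB).
have [n' [S [/andP[n'_gt0 le_n'] sS SB Sdom]]] := HN2 n T B B_free leB.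
exists (n * n'), (A :: S); split=> //=.
- rewrite muln_gt0 n_gt0 n'_gt0 /=; apply: leq_trans (leq_maxr _ _).
  by apply: leq_trans le_nN; rewrite leq_mul2l le_n' orbT.
- by rewrite sS.
- move=> C; rewrite inE => /predU1P[->|/SB[CB lC]].
    by split=> //; apply: leq_trans lA _; rewrite leq_mul // leq_pmulr.
  split; first exact: subset_trans CB BX.
  by apply: leq_trans lB _; rewrite -mulnA leq_mul2l lC orbT.
- rewrite Sdom andbT; apply/allP => C /SB[CB lC].
  apply: (dominates_sub n'_gt0 CB lC) dAB.
  exact: (leq_bigmax (Ordinal (le_n' : n' < (N2 n).+1))).
Qed.

(** * From dense sequences to the EH-property *)

Section Induced.
Variables (T : tournament) (X : {set T}) (X_gt0 : 0 < #|X|).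

Let induced_edge : rel {x : T | x \in X} := fun x y => edge (val x) (val y).

Fact induced_irr : irreflexive induced_edge.
Proof. by move=> x; apply: edge_irr. Qed.

Fact induced_xor (x y : {x : T | x \in X}) :
  x != y -> induced_edge x y (+) induced_edge y x.
Proof. by move=> xy; apply: edge_xor; rewrite val_eqE. Qed.

Fact induced_gt0 : 0 < #|{: {x : T | x \in X}}|.
Proof. by rewrite card_sig. Qed.

Definition induced : tournament := Tournament induced_irr induced_xor induced_gt0.

Lemma card_induced : #|induced| = #|X|.
Proof. exact: card_sig. Qed.

Lemma induced_copy (H : tournament) : contains_copy induced H -> contains_copy T H.
Proof.
case=> x [x_inj xE]; exists (val \o x); split=> [|h h']; last exact: xE.
exact: inj_comp val_inj x_inj.
Qed.

Lemma induced_chain (s : seq induced) : pairwise (@edge induced) s ->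
  exists s' : seq T, [/\ pairwise (@edge T) s', {subset s' <= X} & size s' = size s].
Proof.
move=> s_chain; exists (map val s); split; last exact: size_map.
  by rewrite pairwise_map.
by move=> _ /mapP[x _ ->]; apply: valP.
Qed.

End Induced.

(** * Edge densities *)

Section Density.
Variables (R : realType) (T : tournament).
Implicit Types A B : {set T}.

Lemma edges_betweenE A B : edges_between A B = weight (@edge T) A B.
Proof.
rewrite /weight pair_big /= /edges_between -sum1_card.
rewrite [LHS](eq_bigl (fun p => ((p.1 \in A) && (p.2 \in B)) && edge p.1 p.2)).
  by rewrite [LHS]big_mkcondr; apply: eq_bigr => p _; case: edge.
by move=> p; rewrite inE andbA.
Qed.

Lemma density_dominates l A B : (0 < l)%N -> (0 < #|A|)%N -> (0 < #|B|)%N ->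
  dominates l A B -> (1 - l%:R^-1 <= density R A B)%R.
Proof.
move=> l_gt0 A_gt0 B_gt0 /andP[dAB wAB].
have AB_gt0 : (0 < (#|A| * #|B|)%:R :> R)%R by rewrite ltr0n muln_gt0 A_gt0.
rewrite /density ler_pdivlMr // mulrBl mul1r lerBlDl -lerBlDr.
have wD := weightD (@edge T) A B; rewrite -edges_betweenE in wD.
rewrite -wD natrD addrAC subrr add0r mulrC ler_pdivlMr ?ltr0n //.
rewrite -natrD wD -natrM ler_nat mulnC; apply: leq_trans wAB.
rewrite leq_mul2l weightC; apply/orP; right; rewrite leq_eqVlt; apply/orP; left.
apply/eqP/eq_weight => y x yB xA; rewrite (@edgeC _ x y) //.
by apply: contraTneq yB => <-; rewrite (disjointFr dAB xA).
Qed.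

Lemma density1_complete A B : density R A B = 1%R -> complete_to A B.
Proof.
(* If [A] or [B] is empty, division by 0 makes the density 0, not 1. *)
rewrite /density; case: (eqVneq (#|A| * #|B|)%N 0) => [->|AB0].
  by rewrite invr0 mulr0 => /eqP; rewrite eq_sym oner_eq0.
move/divr1_eq/eqP; rewrite eqr_nat => /eqP eAB x y xA yB.
have /eqP : [set p : T * T | [&& p.1 \in A, p.2 \in B & edge p.1 p.2]] == setX A B.
  rewrite eqEcard cardsX -eAB leqnn andbT; apply/subsetP => p.
  by rewrite !inE => /and3P[-> ->].
by move/setP/(_ (x, y)); rewrite !inE /= xA yB.
Qed.

End Density.

Lemma powR_gt_sub1 (R : realType) (d : R) : (0 < d < 1)%R ->
  exists2 eps : R, (0 < eps)%R & (1 - d < d `^ eps)%R.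
Proof.
case/andP=> d_gt0 d_lt1.
have d1_gt0 : (0 < 1 - d)%R by rewrite subr_gt0.
have lnd : (ln d < 0)%R by rewrite ln_lt0 // d_gt0.
have lnd1 : (ln (1 - d) < 0)%R by rewrite ln_lt0 // d1_gt0 gtrBl.
(* This exponent turns [d] into the square root of [1 - d], which exceeds [1 - d]. *)
exists (ln (1 - d) / ln d / 2)%R.
  by rewrite divr_gt0 // nmulr_rgt0 // invr_lt0.
rewrite /powR gt_eqF // -{1}(lnK (d1_gt0 : (1 - d)%R \is Num.pos)) ltr_expR.
rewrite mulrAC mulfVK ?lt_eqF //.
by rewrite ltr_nMr // invf_lt1 // ltr1n.
Qed.

Lemma lower_bound_seq (R : realType) (f : nat -> R) N : (forall n, (0 < f n)%R) ->
  exists2 d : R, (0 < d)%R & forall n, (n <= N)%N -> (d <= f n)%R.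
Proof.
move=> f_gt0; elim: N => [|N [d d_gt0 dP]].
  by exists (f 0) => // n; rewrite leqn0 => /eqP ->.
exists (Num.min d (f N.+1)); first by rewrite lt_min d_gt0 f_gt0.
by move=> n; rewrite leq_eqVlt ge_min => /predU1P[->|/dP ->]; rewrite ?lexx ?orbT.
Qed.

(** * Construction of m-sequences *)

Lemma eta_at_gt0 m (v : m.-tuple bool) (eta : (count id v).-tuple nat) (i : 'I_m) :
  (forall a, 0 < tnth eta a) -> tnth v i -> 0 < eta_at eta i.
Proof.
move=> eta_gt0 vi.
have z_gt0 : 0 < zeta v i by apply/card_gt0P; exists i; rewrite inE leqnn.
have z_le : zeta v i <= count id v.
  rewrite -(map_tnth_enum v) count_map -size_filter.
  rewrite -(card_uniqP (filter_uniq _ (enum_uniq _))); apply/subset_leq_card.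
  by apply/subsetP => j; rewrite inE mem_filter mem_enum andbT => /andP[].
have lt_z : (zeta v i).-1 < count id v by rewrite prednK.
by have := eta_gt0 (Ordinal lt_z); rewrite (tnth_nth 0).
Qed.

(** A transitive subset of a linear-size set is too small to inherit its densities, so the dense
    sets are replaced through [clean_family]. The constant [(2 * e * n.+1)^-1] does not involve [l],
    so [l n] may be chosen in terms of it. *)
Lemma mseq_exists (R : realType) (H : tournament) m (v : m.-tuple bool)
    (eta : (count id v).-tuple nat) :
    (forall a, 0 < tnth eta a) ->
  exists2 e, 0 < e & forall l : nat -> nat, (forall n, 1 < l n) ->
  exists N, forall T : tournament,
    free_on H [set: T] -> N <= #|T| -> e <= tr T ->
    (forall n (Y : {set T}), n <= 2 * N -> #|T| <= n * #|Y| ->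
       exists s, [/\ pairwise (@edge T) s, {subset s <= Y} & tr T <= 2 * size s]) ->
  exists n (chi : mseq_data m T), n <= N /\
    is_mseq eta ((2 * e * n.+1)%:R^-1 : R) (l n)%:R^-1 chi.
Proof.
move=> eta_gt0.
pose e := (\max_(i < m) eta_at eta i).+1.
have eta_lt i : eta_at eta i < e by rewrite ltnS; apply: leq_bigmax.
(* The available chains have length at least [tr T / 2], hence at least the inner [e], enough to cut
   them into nonempty parts. *)
exists (2 * e) => // l l_gt1.
(* The factor [(2 * m) ^ m] is what [clean_family] consumes. *)
have [N HN] := dominating_sequence H m (fun n => (2 * m) ^ m * l n).
exists N => T T_free leN le_e Hchain.
have T_gt0 := vertex_gt0 T.
have := HN T [set: T] T_free; rewrite cardsT => /(_ leN).
case=> n [S [/andP[n_gt0 le_n] sS SX Sdom]].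
pose Si (i : 'I_m) := nth set0 S i.
have SiX i : #|T| <= n * #|Si i|.
  by have [] := SX (Si i) _; first by apply: mem_nth; rewrite sS.
have Si_gt0 i : 0 < #|Si i|.
  by case: (#|Si i|) (SiX i) => //; rewrite muln0 leqNgt T_gt0.
have Si_dom (i j : 'I_m) : i < j -> dominates ((2 * m) ^ m * l n) (Si i) (Si j).
  by move=> ij; apply: (pairwiseP set0 Sdom); rewrite ?inE ?sS.
(* Backward edges, whichever index comes first; this gives the symmetry that [clean_family] asks
   for. *)
pose Rel (i j : 'I_m) (x y : T) :=
  if i < j then edge y x else if j < i then edge x y else false.
have RelC i j x y : Rel i j x y = Rel j i y x.
  by rewrite /Rel; case: (ltngtP i j).
pose Q (i : 'I_m) (Z : {set T}) := if tnth v i then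
    exists P, [/\ transitive_on Z, size P = eta_at eta i, ordered_partition Z P &
      forall X, X \in P -> tr T <= 2 * (2 * e) * n.+1 * #|X|]
  else #|T| <= 2 * (2 * e) * n.+1 * #|Z|.
have [i Y YS leY|i j ij|Z [ZS ZQ Zsp]] := clean_family (Q := Q) RelC Si_gt0 (l := l n).
- have leTY : #|T| <= 2 * n * #|Y|.
    apply: leq_trans (SiX i) _; rewrite [2 * n]mulnC -mulnA leq_mul2l leY.
    by rewrite orbT.
  rewrite /Q; case E: (tnth v i); last first.
    exists Y; split=> //; first by case: (#|Y|) leTY => //; rewrite muln0; lia.
    apply: leq_trans leTY _; rewrite leq_mul // -!mulnA leq_mul2l /=.
    by rewrite mulnA; nia.
  have [s [s_chain sY tr_s]] := Hchain _ Y (leq_mul (leqnn 2) le_n) leTY.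
  have eta_i_gt0 := eta_at_gt0 eta_gt0 E.
  have le_es : e <= size s by rewrite -(leq_pmul2l (isT : 0 < 2)) (leq_trans le_e).
  set q := size s %/ eta_at eta i.
  have q_gt0 : 0 < q by rewrite divn_gt0 // ltnW // (leq_trans (eta_lt i)).
  have [|P [sP Ppart Pq]] := @chain_cut T s (eta_at eta i).-1 q s_chain.
    by rewrite prednK // mulnC leq_divM.
  exists [set x in s]; split.
  + by apply/subsetP => x; rewrite inE => /sY.
  + by rewrite cardsE (card_uniqP (chain_uniq s_chain)); apply: leq_trans le_es.
  + exists P; split=> //; first exact: chain_transitive.
      by rewrite sP prednK.
    (* Rounding in [q] costs a factor 2, as does [tr T <= 2 * size s]; this explains
       [2 * (2 * e)]. *)
    move=> X /Pq leX; apply: leq_trans tr_s _.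
    have := divn_eq (size s) (eta_at eta i); rewrite -/q.
    have := ltn_pmod (size s) eta_i_gt0; have := eta_lt i.
    move: (eta_at eta i) (_ %% _) => a b lt_ae lt_ba ->.
    have : a * q <= e * #|X| by apply: leq_mul => //; apply: ltnW.
    have : a <= a * q by rewrite leq_pmulr.
    have : e * #|X| <= e * n.+1 * #|X| by rewrite leq_mul // leq_pmulr.
    rewrite -!mulnA; move: (e * _) (e * _) => f g; lia.
- rewrite card_ord /Rel; case: (ltngtP i j) ij => [lt_ij|lt_ji|/val_inj -> /[!eqxx]//] _.
    by rewrite weightC mulnC; have /andP[_] := Si_dom i j lt_ij; rewrite mulnC.
  by have /andP[_] := Si_dom j i lt_ji; rewrite [leqRHS]mulnC.
have /choice[P HP] i : exists P, tnth v i ->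
    [/\ transitive_on (Z i), size P = eta_at eta i, ordered_partition (Z i) P &
      forall X, X \in P -> tr T <= 2 * (2 * e) * n.+1 * #|X|].
  have := ZQ i; rewrite /Q; case: (tnth v i) => [[P HP]|_]; first by exists P.
  by exists [::].
exists n, (MSeqData Z P); split=> //.
have c_gt0 : (0 < (2 * (2 * e) * n.+1)%:R :> R)%R by rewrite ltr0n !muln_gt0.
have c_le a b : a <= 2 * (2 * e) * n.+1 * b ->
    ((2 * (2 * e) * n.+1)%:R^-1 * a%:R <= b%:R :> R)%R.
  by move=> le_ab; rewrite ler_pdivrMl // -natrM ler_nat.
have Z_gt0 i : 0 < #|Z i|.
  have := ZQ i; rewrite /Q; case E: (tnth v i); last first.
    by case: (#|Z i|) => //; rewrite muln0 leqNgt T_gt0.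
  case=> [[|X P']] [_ /= sP' [-> _ _] leX].
    by have := eta_at_gt0 eta_gt0 E; rewrite -sP'.
  have := leX X (mem_head _ _); rewrite big_cons.
  have : #|X| <= #|X :|: \bigcup_(X0 <- P') X0| by apply/subset_leq_card/subsetUl.
  case: (#|X|) => [|k]; last by case: (#|_ :|: _|).
  rewrite muln0; lia.
have Zdis i j : i != j -> [disjoint Z i & Z j].
  move=> ij; apply: disjointWl (ZS i) (disjointWr (ZS j) _).
  case: (ltngtP i j) ij => [/Si_dom/andP[]//|/Si_dom/andP[+ _ _]|/val_inj->/[!eqxx]//].
  by rewrite disjoint_sym.
split=> /=.
- rewrite invr_gt0 c_gt0 invr_ge0 ler0n; split=> //=.
  by rewrite invf_lt1 ?ltr0n ?ltr1n // ltnW.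
- exact: Zdis.
- move=> i vi; have [Ztr sP Ppart leX] := HP i vi; split=> // X /leX.
  exact: c_le.
- by move=> i vi; have := ZQ i; rewrite /Q vi; apply: c_le.
- move=> i j ij; have nij : i != j by rewrite -val_eqE ltn_eqF.
  apply: density_dominates => //; first by rewrite ltnW.
  rewrite /dominates Zdis // weightC.
  by have := Zsp i j nij; rewrite /Rel ij.
Qed.

(** * Strong pairs and minimal counterexamples *)

Lemma chain_cat (T : tournament) (s1 s2 : seq T) (A B : {set T}) :
  complete_to A B -> {subset s1 <= A} -> {subset s2 <= B} ->
  pairwise (@edge T) s1 -> pairwise (@edge T) s2 -> pairwise (@edge T) (s1 ++ s2).
Proof.
move=> AB sA sB c1 c2; rewrite pairwise_cat c1 c2 !andbT.
by apply/allrelP => x y /sA xA /sB yB; apply: AB.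
Qed.

(** A chain of more than [(1 - d) * tr T] vertices in [A] and one of at least [d * tr T] in [B] join
    to a chain longer than [tr T]. *)
Lemma no_strong_pair (R : realType) (T : tournament) m (chi : mseq_data m T)
    (c d : R) (A B : {set T}) : (d <= 2^-1)%R -> (d <= c)%R ->
  (forall Y : {set T}, (d * #|T|%:R <= #|Y|%:R)%R -> exists s,
     [/\ pairwise (@edge T) s, {subset s <= Y} &
         ((1 - d) * (tr T)%:R < (size s)%:R :> R)%R]) ->
  ~ strong_pair chi c A B.
Proof.
move=> d_le2 d_le_c big [_ _ leA leB dens].
have dc x : (d * x%:R <= c * x%:R)%R by rewrite ler_wpM2r.
have [sA [cA sAA ltA]] := big A (le_trans (dc _) leA).
have [sB [cB sBB ltB]] : exists s, [/\ pairwise (@edge T) s, {subset s <= B} &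
    (d * (tr T)%:R <= (size s)%:R :> R)%R].
  case: leB => [leB|[Btr leB]].
    have [s [cs sY lts]] := big B (le_trans (dc _) leB); exists s; split=> //.
    apply: le_trans (ltW lts); rewrite ler_wpM2r //; lra.
  have [s cs BE] := transitive_chain Btr; exists s; split=> //.
    by move=> x xs; rewrite BE inE.
  apply: le_trans (dc _) (le_trans leB _).
  by rewrite BE cardsE (card_uniqP (chain_uniq cs)).
have lt_tr : tr T < size sA + size sB.
  by rewrite -(ltr_nat R) natrD; lra.
have [] : pairwise (@edge T) (sA ++ sB) \/ pairwise (@edge T) (sB ++ sA).
- by case: dens => /density1_complete cAB; [left|right]; apply: chain_cat cAB _ _ _ _.
- by move/tr_ge_chain; rewrite size_cat leqNgt lt_tr.
- by move/tr_ge_chain; rewrite size_cat addnC leqNgt lt_tr.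
Qed.

Section Critical.
Variables (R : realType) (eps d : R) (T : tournament).
Hypotheses (eps_gt0 : (0 < eps)%R) (d_gt0 : (0 < d)%R) (d_lt1 : (d < 1)%R).
Hypothesis d_eps : (1 - d < d `^ eps)%R.
Hypothesis T_critical : ((tr T)%:R < #|T|%:R `^ eps)%R.
Hypothesis sub_T : forall Y : {set T}, 0 < #|Y| < #|T| -> exists s,
  [/\ pairwise (@edge T) s, {subset s <= Y} & (#|Y|%:R `^ eps <= (size s)%:R :> R)%R].

Let T_gt0 : (0 < #|T|%:R :> R)%R.
Proof. by rewrite ltr0n vertex_gt0. Qed.

Lemma critical_tr_gt1 : 1 < tr T.
Proof.
have T_gt1 : 1 < #|T|.
  rewrite ltnNge; apply/negP => T_le1.
  have T1 : #|T| = 1 by apply/eqP; rewrite eqn_leq T_le1 vertex_gt0.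
  move: T_critical; rewrite T1 powR1 ltNge ler1n => /negP; apply.
  have [|s cs [_ ss]] := @chain_log T 0 [set: T]; first by rewrite cardsT T1.
  by rewrite -ss tr_ge_chain.
have [|s cs [_ ss]] := @chain_log T 1 [set: T]; first by rewrite cardsT.
by rewrite -ss tr_ge_chain.
Qed.

(** For proper [Y], minimality gives a chain of length at least [#|Y|^eps >= d^eps * #|T|^eps],
    where [d^eps > 1 - d] and [#|T|^eps > tr T]. For [Y = T] a maximum chain serves. *)
Lemma critical_chain (Y : {set T}) : (d * #|T|%:R <= #|Y|%:R)%R -> exists s,
  [/\ pairwise (@edge T) s, {subset s <= Y} &
      ((1 - d) * (tr T)%:R < (size s)%:R :> R)%R].
Proof.
move=> leY; have tr_gt0 : (0 < (tr T)%:R :> R)%R.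
  by rewrite ltr0n (ltn_trans _ critical_tr_gt1).
have Y_gt0 : 0 < #|Y|.
  by rewrite -(ltr0n R); apply: lt_le_trans leY; apply: mulr_gt0.
have [YT|ltY] := leqP #|T| #|Y|.
  have -> : Y = setT by apply/eqP; rewrite eqEcard subsetT cardsT.
  have [s cs ss] := tr_chain T; exists s; split=> //; first by move=> x _; rewrite inE.
  by rewrite ss gtr_pMl // gtrBl.
have [|s [cs sY les]] := sub_T (Y := Y); first by rewrite Y_gt0.
exists s; split=> //; apply: lt_le_trans les.
apply: (@lt_le_trans _ _ (d `^ eps * #|T|%:R `^ eps)%R).
  by apply: ltr_pM; rewrite ?ler0n ?subr_ge0 ?(ltW d_lt1).
rewrite -powRM ?ler0n ?(ltW d_gt0) //.
by apply: ge0_ler_powR; rewrite ?nnegrE ?ler0n ?(ltW eps_gt0) // mulr_ge0 // ltW.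
Qed.

(** Otherwise [d * #|T| <= 1], so [d^eps * #|T|^eps <= 1]; but this product exceeds
    [(1 - d) * tr T], which is at least [2^-1 * 2]. *)
Lemma critical_large N : (d * N%:R <= 1)%R -> (d <= 2^-1)%R -> N <= #|T|.
Proof.
move=> dN d_le2; rewrite leqNgt; apply/negP => ltN.
have d1 : (d * #|T|%:R <= 1)%R.
  by apply: le_trans dN; rewrite ler_pM2l // ler_nat ltnW.
have : (d `^ eps * #|T|%:R `^ eps <= 1)%R.
  have one_eps : (1 `^ eps = 1 :> R)%R by rewrite powR1.
  rewrite -powRM ?ler0n ?(ltW d_gt0) // -[leRHS]one_eps.
  by apply: ge0_ler_powR; rewrite ?nnegrE ?ler01 ?(ltW eps_gt0) // mulr_ge0 // ltW.
rewrite leNgt => /negP; apply.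
have le_tr : (2 <= (tr T)%:R :> R)%R by rewrite ler_nat critical_tr_gt1.
apply: (@le_lt_trans _ _ ((1 - d) * (tr T)%:R)%R).
  apply: (@le_trans _ _ (2^-1 * 2)%R); first by rewrite mulVf ?pnatr_eq0.
  by apply: ler_pM => //; lra.
by apply: ltr_pM; rewrite ?ler0n ?subr_ge0 ?(ltW d_lt1).
Qed.

End Critical.

(** * Choice of the constants and conclusion *)

Lemma inv_nat_le (R : realType) (x : R) : (0 < x)%R ->
  exists2 l : nat, 1 < l & (l%:R^-1 <= x)%R.
Proof.
move=> x_gt0; exists (Num.truncn x^-1).+2 => //.
rewrite invf_ple ?posrE ?ltr0n //.
apply/ltW/(lt_trans (truncnS_gt _)); by rewrite ltr_nat.
Qed.

Theorem theorem6 (R : realType) (t : nat) (H : 'I_t -> tournament)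
    (t_gt0 : (0 < t)%N)
    (m : nat) (v : m.-tuple bool) (eta : (count id v).-tuple nat)
    (eta_gt0 : forall a : 'I_(count id v), (0 < tnth eta a)%N)
    (F : forall i : 'I_t, H i -> 'I_(long_length eta))
    (F_inj : forall i : 'I_t, injective (F i)) :
  strong_EH_property R F -> EH_property R H.
Proof.
move=> strong; pose H0 := H (Ordinal t_gt0).
have [e e_gt0 mseqP] := mseq_exists R H0 eta_gt0.
have c1_gt0 n : (0 < (2 * e * n.+1)%:R^-1 :> R)%R.
  by rewrite invr_gt0 ltr0n !muln_gt0 e_gt0.
(* At scale [n] the strong property is applied with [c1 = (2 * e * n.+1)^-1], and [l n] is chosen
   with [(l n)^-1 <= lambda0]. Freeness excludes the alternative of a copy. *)
have /choice[l /choice[c Hlc]] n : exists (l : nat) (c : R), [/\ 1 < l, (0 < c)%R &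
    forall (T : tournament) (chi : mseq_data m T),
    (forall i, ~ contains_copy T (H i)) ->
    is_mseq eta ((2 * e * n.+1)%:R^-1 : R) l%:R^-1 chi ->
    exists A B, strong_pair chi c A B].
  have [lambda0 [c [lambda0_gt0 c_gt0 HT]]] := strong _ (c1_gt0 n).
  have [l l_gt1 le_l] := inv_nat_le lambda0_gt0.
  exists l, c; split=> // T chi T_free chiP.
  have [||[i [x [_ x_emb]]]|//] := HT T l%:R^-1%R chi.
  - by rewrite invr_ge0 ler0n.
  - exact: chiP.
  - by case: (T_free i); exists x.
have [|N HN] := mseqP l; first by move=> n; case: (Hlc n).
(* [2 * N] bounds the scales at which long chains are requested; [2 ^ e] vertices guarantee
   [e <= tr T]. *)
pose M := maxn (2 * N) (2 ^ e).
have [|d0 d0_gt0 d0P] := @lower_bound_seq R c N; first by move=> n; case: (Hlc n).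
(* Only scales [n <= N] occur, so one positive [d] lies below all relevant [c n]; it also satisfies
   [d <= 1/2] and [d * M <= 1]. *)
pose d := Num.min d0 (Num.min 2^-1 M.+1%:R^-1)%R.
have d_gt0 : (0 < d)%R by rewrite !lt_min d0_gt0 !invr_gt0 !ltr0n.
have d_le2 : (d <= 2^-1)%R by rewrite !ge_min lexx orbT.
have d_leM : (d <= M.+1%:R^-1)%R by rewrite !ge_min lexx !orbT.
have d_lec n : n <= N -> (d <= c n)%R.
  by move=> /d0P; apply: le_trans; rewrite ge_min lexx.
have d_lt1 : (d < 1)%R by lra.
have [|eps eps_gt0 d_eps] := @powR_gt_sub1 R d; first by rewrite d_gt0.
have dM k : k <= M -> (d * k%:R <= 1)%R.
  move=> le_k; apply: (@le_trans _ _ (M.+1%:R^-1 * M.+1%:R)%R); last first.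
    by rewrite mulVf // pnatr_eq0.
  by apply: ler_pM; rewrite ?ler0n ?(ltW d_gt0) // ler_nat ltnW.
exists eps => // T.
(* Strong induction on [#|T|]: if the bound fails at [T], then [T] is a minimal counterexample. *)
have [k] := ubnP #|T|; elim: k T => // k IHk T; rewrite ltnS => leT T_free.
have [s0 s0_chain s0E] := tr_chain T.
have [le_tr|T_crit] := lerP (#|T|%:R `^ eps)%R (tr T)%:R.
  exists [set x in s0]; split; first exact: chain_transitive.
  by rewrite cardsE (card_uniqP (chain_uniq s0_chain)) s0E.
have sub_T (Y : {set T}) : 0 < #|Y| < #|T| -> exists s,
    [/\ pairwise (@edge T) s, {subset s <= Y} &
        (#|Y|%:R `^ eps <= (size s)%:R :> R)%R].
  case/andP=> Y_gt0 ltY; have [||X [Xtr leX]] := IHk (induced Y_gt0).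
  - by rewrite card_induced (leq_trans ltY).
  - by move=> i /induced_copy; apply: T_free.
  have [s s_chain XE] := transitive_chain Xtr.
  have [s' [cs' sY ss']] := induced_chain s_chain; exists s'; split=> //.
  move: leX; rewrite card_induced XE cardsE ss'.
  by rewrite (card_uniqP (chain_uniq s_chain)).
have big := critical_chain eps_gt0 d_gt0 d_lt1 d_eps T_crit sub_T.
have large := critical_large eps_gt0 d_gt0 d_lt1 d_eps T_crit.
have [||||n [chi [le_n chiP]]] := HN T.
- by case=> x x_emb _; apply: (T_free (Ordinal t_gt0)); exists x.
- by apply: large => //; apply: dM; rewrite leq_max; lia.
- have [|s cs [_ ss]] := @chain_log T e [set: T].
    by rewrite cardsT; apply: large => //; apply: dM; rewrite leq_maxr.
  by rewrite ltnW // -ss tr_ge_chain.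
(* Since [d * n <= 1], the set [Y] has at least [d * #|T|] vertices, and [1 - d >= 1/2] gives the
   factor 2. *)
- move=> n Y le_n leY; have [|s [cs sY lts]] := big Y.
    have dn : (d * n%:R <= 1)%R by apply: dM; rewrite (leq_trans le_n) ?leq_maxl.
    apply: (@le_trans _ _ (d * (n * #|Y|)%:R)%R); first by rewrite ler_pM2l // ler_nat.
    by rewrite natrM mulrA ler_piMl.
  exists s; split=> //; rewrite -(ler_nat R) natrM.
  have tr_ge0 : (0 <= (tr T)%:R :> R)%R by [].
  have : (2^-1 * (tr T)%:R <= (1 - d) * (tr T)%:R :> R)%R.
    by apply: ler_wpM2r => //; lra.
  lra.
have [_ _ Hn] := Hlc n; have [A [B AB]] := Hn T chi T_free chiP.
by case: (no_strong_pair d_le2 (d_lec n le_n) big AB).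
Qed.
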